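(* Let $\mathcal{P}^{1/2}_\Theta=\{\sqrt{p_\theta}\colon\theta\in\Theta\subset\mathbb{R}^m\}$ be an $m$-dimensional manifold of square roots of probability densities on $\mathbb{X}$ with respect to $\lambda$. Let $\theta_F(t)\in\Theta$ be the curve defined by the projection prediction equation $$\partial_t\sqrt{p_{\theta_F}} = \Pi_{\theta_F}\circ\mathcal{F}^{1/2}\big[\sqrt{p_{\theta_F}}\big],\qquad \mathcal{F}^{1/2}[\phi]=\frac{\phi}{2\phi^2}\,\mathcal{G}^a[\phi^2].$$ Then this curve is given by $$\dot\theta_F = g^{-1}(\theta_F)\,\mathbb{E}_{\theta_F}\big[\mathcal{G}[\nabla_{\theta_F}\log p_{\theta_F}]\big].$$
   Context: $\mathbb{X}$ is a submanifold of $\mathbb{R}^d$ with base measure $\lambda$, and $X$ is an Itô process $\mathrm{d}X = a(t,X)\,\mathrm{d}t+\sigma(t,X)\,\mathrm{d}W$ taking values in $\mathbb{X}$, where $W$ is a standard Wiener process on $\mathbb{R}^q$; put $Q=\sigma\sigma^{\mathsf T}$. Its generator is $\mathcal{G}[\phi] = \sum_i a_i\,\partial_i\phi + \frac12\sum_{i,j}Q_{i,j}\,\partial^2_{i,j}\phi$ (derivatives in $x$; applied componentwise to vector-valued functions), and $\mathcal{G}^a$ is its (formal) adjoint in $\mathcal{L}_2(\mathbb{X},\lambda)$: $\int_{\mathbb{X}}\mathcal{G}[\phi]\,p\,\mathrm{d}\lambda=\int_{\mathbb{X}}\phi\,\mathcal{G}^a[p]\,\mathrm{d}\lambda$. The family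 $\mathcal{P}^{1/2}_\Theta\subset\mathcal{L}_2(\mathbb{X},\lambda)$ has one global smooth coordinate chart $\theta\mapsto\sqrt{p_\theta}$. Its tangent space at $\sqrt{p_\theta}$ is $\operatorname{span}\{\partial^\theta_1\sqrt{p_\theta},\dots,\partial^\theta_m\sqrt{p_\theta}\}$, where $\partial_i^\theta=\partial/\partial\theta_i$, and $\langle\partial_i^\theta\sqrt{p_\theta},\partial_j^\theta\sqrt{p_\theta}\rangle=\frac14 g_{i,j}(\theta)$ in $\mathcal{L}_2(\mathbb{X},\lambda)$, where $g(\theta)$ is the Fisher information matrix. The orthogonal projection of $\mathcal{L}_2(\mathbb{X},\lambda)$ onto this tangent space is $$\Pi_\theta v = 4\sum_{i,j} g^{-1}_{i,j}(\theta)\,\langle v,\partial^\theta_j\sqrt{p_\theta}\rangle\,\partial^\theta_i\sqrt{p_\theta}.$$ $\mathbb{E}_\theta$ denotes expectation under the density $p_\theta$ with respect to $\lambda$. The setting is formal: the expressions involved are assumed to make sense. *)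

(* Defs.v *)
(* MathComp-Analysis.  Points of R^d and of R^m are column vectors. *)
From HB Require Import structures.
From mathcomp Require Import all_boot all_order all_algebra.
From mathcomp Require Import all_classical all_reals all_analysis.

Set Implicit Arguments.
Unset Strict Implicit.
Unset Printing Implicit Defensive.
Import Order.TTheory GRing.Theory Num.Theory.
Import numFieldNormedType.Exports.
Local Open Scope classical_set_scope.
Local Open Scope ring_scope.

Notation borelType R d := (g_sigma_algebraType (@open 'cV[R]_d)).

Notation basis_vec i := (delta_mx i 0).

Section differential_calculus.
Context {R : realType} {d : nat}.
Implicit Types (f : 'cV[R]_d -> R) (U X : set 'cV[R]_d).

Definition partial (i : 'I_d) f : 'cV[R]_d -> R :=
  fun x => 'D_(basis_vec i) f x.

(* f is of class C^k on U; meant for open U. *)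
Fixpoint Ck_on (k : nat) U f : Prop :=
  if k is k'.+1 then
    (forall x, U x -> differentiable f x) /\
    (forall i, Ck_on k' U (partial i f))
  else forall x, U x -> {for x, continuous f}.

Definition smooth_on U f := forall k, Ck_on k U f.

(* X is an embedded smooth submanifold of R^d (without boundary) of dimension
   d - c: locally a regular level set of c smooth functions. *)
Definition submanifold X := exists c : nat, forall x, X x ->
  exists (U : set 'cV[R]_d) (F : 'I_c -> 'cV[R]_d -> R),
    [/\ open U, U x, forall k, smooth_on U (F k),
        forall y, U y -> (X y <-> forall k, F k y = 0)
      & forall y, U y -> X y ->
          row_free (\matrix_(k < c, j < d) partial j (F k) y)].

Definition C2_near X f :=
  exists U : set 'cV[R]_d, [/\ open U, X `<=` U & Ck_on 2 U f].

(* The generator of dX = a(t, X) dt + sigma(t, X) dW, with W a Wiener process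
   on R^q.  Functions on X are represented by functions on R^d: the derivatives
   are those of R^d. *)
Definition generator (q : nat) (a : R -> 'cV[R]_d -> 'cV[R]_d)
    (sigma : R -> 'cV[R]_d -> 'M[R]_(d, q)) (t : R) f : 'cV[R]_d -> R :=
  fun x =>
    let Q := sigma t x *m (sigma t x)^T in
    \sum_i a t x i 0 * partial i f x +
    2^-1 * \sum_i \sum_j Q i j * partial i (partial j f) x.

End differential_calculus.

Section L2.
Context {R : realType} {d : nat}.
Variables (X : set 'cV[R]_d) (lam : {measure set (borelType R d) -> \bar R}).
Implicit Types f g v : 'cV[R]_d -> R.

Definition in_L2 f : Prop := ((f \_ X : borelType R d -> R) \in Lfun lam 2%:E).

Definition L2_norm f : \bar R := 'N[lam]_2%:E [EFin \o (f \_ X)].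

Definition inner f g : R := (\int[lam]_(x in X) (f x * g x))%R.

(* The map f from E to L_2(X, lam) is Frechet differentiable at e, with
   differential L. *)
Definition is_L2_diff (E : normedModType R) (f : E -> 'cV[R]_d -> R) (e : E)
    (L : E -> 'cV[R]_d -> R) : Prop :=
  L2_norm (fun x => `|h|^-1 * (f (e + h) x - f e x - L h x)) @[h --> 0^']
    --> 0%E.

(* The curve gamma in L_2(X, lam) has time derivative v at t. *)
Definition is_L2_derive (gamma : R -> 'cV[R]_d -> R) (t : R) v : Prop :=
  @is_L2_diff R^o gamma t (fun h x => h * v x).

(* f, as a map from Theta to L_2(X, lam), is of class C^k; meant for open
   Theta. *)
Fixpoint L2_Ck (m k : nat) (Theta : set 'cV[R]_m)
    (f : 'cV[R]_m -> 'cV[R]_d -> R) : Prop :=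
  (forall th, Theta th -> in_L2 (f th)) /\
  if k is k'.+1 then
    exists df : 'I_m -> 'cV[R]_m -> 'cV[R]_d -> R,
      (forall th, Theta th ->
         is_L2_diff f th (fun h x => \sum_i h i 0 * df i th x)) /\
      (forall i, L2_Ck k' Theta (df i))
  else
    forall th, Theta th ->
      L2_norm (fun x => f eta x - f th x) @[eta --> th] --> 0%E.

Definition L2_smooth (m : nat) (Theta : set 'cV[R]_m)
    (f : 'cV[R]_m -> 'cV[R]_d -> R) : Prop := forall k, L2_Ck k Theta f.

(* Ga is an adjoint of G in L_2(X, lam), for test functions in DG and densities
   in DGa. The two classes are those on which the integrations by parts are
   licit; they are part of the data. *)
Definition formal_adjoint (DG DGa : set ('cV[R]_d -> R))
    (G Ga : ('cV[R]_d -> R) -> 'cV[R]_d -> R) : Prop :=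
  forall phi r, DG phi -> DGa r ->
    [/\ lam.-integrable X (EFin \o (fun x => G phi x * r x)),
        lam.-integrable X (EFin \o (fun x => phi x * Ga r x))
      & (\int[lam]_(x in X) (G phi x * r x) =
         \int[lam]_(x in X) (phi x * Ga r x))%R].

End L2.

(* A acts on functions on X: the values of A f on X only depend on f on X. *)
Definition acts_on (R : realType) (d : nat) (X : set 'cV[R]_d)
    (A : ('cV[R]_d -> R) -> 'cV[R]_d -> R) : Prop :=
  forall f g, (forall x, X x -> f x = g x) ->
  forall x, X x -> A f x = A g x.

Section density_family.
Context {R : realType} {d m : nat}.
Variables (X : set 'cV[R]_d) (lam : {measure set (borelType R d) -> \bar R}).
Variables (Theta : set 'cV[R]_m) (p : 'cV[R]_m -> 'cV[R]_d -> R).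
Implicit Types (th : 'cV[R]_m) (i j : 'I_m) (v : 'cV[R]_d -> R).

Definition sqrt_density th : 'cV[R]_d -> R := fun x => Num.sqrt (p th x).

Definition dsqrt_density i th : 'cV[R]_d -> R :=
  fun x => 'D_(basis_vec i) (fun eta => sqrt_density eta x) th.

(* The i-th component of the gradient in theta of log p_theta. *)
Definition score i th : 'cV[R]_d -> R :=
  fun x => 'D_(basis_vec i) (fun eta => ln (p eta x)) th.

(* Expectation under p_th. *)
Definition expect th v : R := (\int[lam]_(x in X) (v x * p th x))%R.

Definition fisher th : 'M[R]_m :=
  \matrix_(i, j) expect th (fun x => score i th x * score j th x).

Definition tangent_proj th v : 'cV[R]_d -> R :=
  fun x => 4 * \sum_i \sum_j invmx (fisher th) i j
             * inner X lam v (dsqrt_density j th) * dsqrt_density i th x.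

(* { sqrt p_th : th in Theta } is an m-dimensional manifold of square roots of
   probability densities, with global smooth chart th |-> sqrt p_th in
   L_2(X, lam): the chart is a smooth injective immersion, and its partial
   derivatives are the pointwise ones. *)
Record sqrt_density_manifold : Prop := {
  sdm_open : open Theta ;
  sdm_pos : forall th, Theta th -> forall x, X x -> 0 < p th x ;
  sdm_meas : forall th, Theta th ->
    measurable_fun (X : set (borelType R d)) (p th : borelType R d -> R) ;
  sdm_mass : forall th, Theta th -> (\int[lam]_(x in X) (p th x)%:E = 1)%E ;
  sdm_smooth : L2_smooth X lam Theta sqrt_density ;
  sdm_inj : forall th eta, Theta th -> Theta eta ->
    ae_eq lam X (sqrt_density th) (sqrt_density eta) -> th = eta ;
  sdm_derivable : forall th, Theta th -> forall x, X x -> forall i,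
    derivable (fun eta => sqrt_density eta x) th (basis_vec i) ;
  sdm_diff : forall th, Theta th ->
    is_L2_diff X lam sqrt_density th
      (fun h x => \sum_i h i 0 * dsqrt_density i th x) ;
  sdm_dL2 : forall th, Theta th -> forall i, in_L2 X lam (dsqrt_density i th) ;
  sdm_immersion : forall th, Theta th -> forall c : 'I_m -> R,
    ae_eq lam X (fun x => \sum_i c i * dsqrt_density i th x) (cst 0) ->
    forall i, c i = 0 }.

End density_family.

(* F^{1/2}[phi] = phi / (2 phi^2) Ga[phi^2]. *)
Definition F_half (R : realType) (d : nat)
    (Ga : ('cV[R]_d -> R) -> 'cV[R]_d -> R) (phi : 'cV[R]_d -> R)
    : 'cV[R]_d -> R :=
  fun x => phi x / (2 * phi x ^+ 2) * Ga (fun y => phi y ^+ 2) x.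

(* Main.v *)
(* By the chain rule in L_2, the curve s |-> sqrt p_(theta s) has derivative
   sum_i theta_i' d_i sqrt p; by hypothesis it also has derivative
   Pi F^{1/2}[sqrt p], which is another combination of the d_i sqrt p.
   Derivatives in L_2 are unique up to null sets and the chart is an immersion,
   so the coefficients agree.  On X, d_i log p = 2 d_i sqrt p / sqrt p, hence
   <F^{1/2}[sqrt p], d_i sqrt p> = 1/4 int G^a[p] d_i log p, and the adjoint
   relation turns the right-hand side into 1/4 E[G[d_i log p]]. *)
Require Import Defs.
From HB Require Import structures.
From mathcomp Require Import all_boot all_order all_algebra.
From mathcomp Require Import all_classical all_reals all_analysis.
From mathcomp Require Import measurable_realfun ring.
Import Order.TTheory GRing.Theory Num.Theory.
Import numFieldNormedType.Exports.
Local Open Scope classical_set_scope.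
Local Open Scope ring_scope.
Set Implicit Arguments.
Unset Strict Implicit.

(** * Square-integrable functions for an arbitrary measure *)

Section Lfun2.
Context {disp : measure_display} {T : measurableType disp} {R : realType}.
Variable mu : {measure set T -> \bar R}.
Implicit Types f g : T -> R.

Lemma Lfun2_0 : (fun=> 0) \in Lfun mu 2%:E.
Proof. exact: (Lfun_submod_closed mu (lee1n 2)).1. Qed.

Lemma Lfun2_linear c f g : f \in Lfun mu 2%:E -> g \in Lfun mu 2%:E ->
  (fun x => c * f x + g x) \in Lfun mu 2%:E.
Proof. exact: (Lfun_submod_closed mu (lee1n 2)).2. Qed.

Lemma Lnorm2Z c f : f \in Lfun mu 2%:E ->
  ('N[mu]_2%:E[EFin \o (fun x => c * f x)%R] =
     `|c|%:E * 'N[mu]_2%:E[EFin \o f])%E.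
Proof. by move=> Lf; exact: (LnormZ (Lfun_Sub (lee1n 2) Lf) c). Qed.

Lemma Lnorm2_eq0 f : f \in Lfun mu 2%:E ->
  'N[mu]_2%:E[EFin \o f]%E = 0%E -> ae_eq mu setT f (cst 0).
Proof.
move=> /sub_Lfun_mfun; rewrite inE => mf f0.
have mEf : measurable_fun setT (EFin \o f) by exact: measurableT_comp.
have := Lnorm_eq0_eq0 mEf (lte0n 2) f0.
by apply: filterS => x /= /(_ I) [].
Qed.

End Lfun2.

(** Transfers what holds near [t] to [t + h] for small nonzero [h]. *)
Lemma cvg_addl_dnbhs (R : realType) (t : R) : t + h @[h --> 0^'] --> t.
Proof.
rewrite -[X in _ --> X]addr0; apply: cvgD; first exact: cvg_cst.
exact: nbhs_dnbhs.
Qed.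

(** * The seminorm of $L_2(X,\lambda)$ and differentiation of maps into this space *)

Section L2_seminorm.
Context {R : realType} {d : nat}.
Variables (X : set 'cV[R]_d) (lam : {measure set (borelType R d) -> \bar R}).
Implicit Types f g : 'cV[R]_d -> R.

(** Membership and seminorm on [X] are defined through extension by zero; linearity of that
    extension reduces them to the whole space. *)
Lemma patch0Z c f : (fun x => c * f x) \_ X = (fun x => c * (f \_ X) x).
Proof. by apply/funext => x; rewrite /patch; case: ifPn; rewrite ?mulr0. Qed.

Lemma patch0D f g :
  (fun x => f x + g x) \_ X = (fun x => (f \_ X) x + (g \_ X) x).
Proof. by apply/funext => x; rewrite /patch; case: ifPn; rewrite ?addr0. Qed.

Lemma in_L2_0 : in_L2 X lam (fun=> 0).
Proof.
rewrite /in_L2.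
have -> : (fun=> 0) \_ X = (fun=> 0) :> ('cV[R]_d -> R).
  by apply/funext => x; rewrite /patch; case: ifPn.
exact: Lfun2_0.
Qed.

Lemma in_L2_linear c f g : in_L2 X lam f -> in_L2 X lam g ->
  in_L2 X lam (fun x => c * f x + g x).
Proof.
rewrite /in_L2 patch0D patch0Z => Lf Lg.
exact: Lfun2_linear.
Qed.

Lemma in_L2Z c f : in_L2 X lam f -> in_L2 X lam (fun x => c * f x).
Proof.
move=> Lf; have := in_L2_linear c Lf in_L2_0.
by under eq_fun do rewrite addr0.
Qed.

Lemma in_L2D f g : in_L2 X lam f -> in_L2 X lam g ->
  in_L2 X lam (fun x => f x + g x).
Proof.
by move=> Lf Lg; have := in_L2_linear 1 Lf Lg; under eq_fun do rewrite mul1r.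
Qed.

Lemma in_L2B f g : in_L2 X lam f -> in_L2 X lam g ->
  in_L2 X lam (fun x => f x - g x).
Proof.
move=> Lf Lg; have := in_L2D Lf (in_L2Z (-1) Lg).
by under eq_fun do rewrite mulN1r.
Qed.

Lemma in_L2_sum (I : Type) (r : seq I) (v : I -> 'cV[R]_d -> R) :
  (forall i, in_L2 X lam (v i)) -> in_L2 X lam (fun x => \sum_(i <- r) v i x).
Proof.
move=> Lv; elim: r => [|i r IH].
  by under eq_fun do rewrite big_nil; exact: in_L2_0.
by under eq_fun do rewrite big_cons; exact: in_L2D.
Qed.

Lemma in_L2_measurable f : in_L2 X lam f ->
  measurable_fun setT (f \_ X : borelType R d -> R).
Proof. by move=> /sub_Lfun_mfun; rewrite inE. Qed.

Lemma L2_norm_ge0 f : (0 <= L2_norm X lam f)%E.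
Proof. exact: Lnorm_ge0. Qed.

Lemma L2_norm_fin f : in_L2 X lam f -> L2_norm X lam f \is a fin_num.
Proof.
move=> /sub_Lfun_finLfun; rewrite inE => fin_f.
by rewrite ge0_fin_numE ?L2_norm_ge0.
Qed.

Lemma L2_norm0 : L2_norm X lam (fun=> 0) = 0%E.
Proof.
rewrite /L2_norm.
have -> : (fun=> 0) \_ X = (fun=> 0) :> ('cV[R]_d -> R).
  by apply/funext => x; rewrite /patch; case: ifPn.
by apply: Lnorm0; rewrite eqe pnatr_eq0.
Qed.

Lemma L2_normZ c f : in_L2 X lam f ->
  L2_norm X lam (fun x => c * f x) = (`|c|%:E * L2_norm X lam f)%E.
Proof.
move=> Lf; rewrite /L2_norm patch0Z.
exact: (Lnorm2Z c Lf).
Qed.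

Lemma ler_L2_normD f g : in_L2 X lam f -> in_L2 X lam g ->
  (L2_norm X lam (fun x => f x + g x)%R <= L2_norm X lam f + L2_norm X lam g)%E.
Proof.
move=> Lf Lg; rewrite /L2_norm patch0D.
by apply: minkowski_EFin; rewrite ?ler1n //; exact: in_L2_measurable.
Qed.

Lemma ler_L2_norm_sum (I : Type) (r : seq I) (v : I -> 'cV[R]_d -> R) :
  (forall i, in_L2 X lam (v i)) ->
  (L2_norm X lam (fun x => \sum_(i <- r) v i x)%R <=
     \sum_(i <- r) L2_norm X lam (v i))%E.
Proof.
move=> Lv; elim: r => [|i r IH].
  by under eq_fun do rewrite big_nil; rewrite L2_norm0 big_nil.
under eq_fun do rewrite big_cons.
rewrite big_cons (le_trans (ler_L2_normD _ _)) ?leeD2l //.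
exact: in_L2_sum.
Qed.

Lemma L2_norm_eq0 f : in_L2 X lam f -> L2_norm X lam f = 0%E ->
  ae_eq lam X f (cst 0).
Proof.
move=> Lf f0; have := Lnorm2_eq0 Lf f0.
apply: filterS => x /= /(_ I); rewrite /patch => + Xx.
by rewrite mem_set.
Qed.

(** The increments of [gamma] cancel in the difference of the two remainders, leaving [v - w] times
    a scalar of modulus 1. Hence the fixed norm of [v - w] is at most a sum tending to 0. *)
Lemma is_L2_derive_unique (gamma : R -> 'cV[R]_d -> R) t v w :
  (\forall s \near t, in_L2 X lam (gamma s)) ->
  in_L2 X lam v -> in_L2 X lam w ->
  is_L2_derive X lam gamma t v -> is_L2_derive X lam gamma t w ->
  ae_eq lam X (fun x => v x - w x) (cst 0).
Proof.
move=> Lgamma Lv Lw dv dw; apply: L2_norm_eq0; first exact: in_L2B.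
pose rem u (h : R) := L2_norm X lam
  (fun x => `|h|^-1 * (gamma (t + h) x - gamma t x - h * u x)).
apply/eqP; rewrite eq_le L2_norm_ge0 andbT.
have cvg_rem : (rem v h + rem w h)%E @[h --> 0^'] --> 0%E.
  by rewrite -[X in _ --> X](adde0 0%E); exact: cvgeD.
apply: (cvge_to_ge cvg_rem).
have Lgamma0 := nbhs_singleton Lgamma.
near=> h.
have h0 : h != 0 by near: h; exact: nbhs_dnbhs_neq.
have Lgammah : in_L2 X lam (gamma (t + h)).
  near: h; exact: cvg_addl_dnbhs Lgamma.
have Lrem u : in_L2 X lam u -> in_L2 X lam
    (fun x => `|h|^-1 * (gamma (t + h) x - gamma t x - h * u x)).
  by move=> Lu; apply/in_L2Z/in_L2B; [exact: in_L2B|exact: in_L2Z].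
have := ler_L2_normD (Lrem v Lv) (in_L2Z (-1) (Lrem w Lw)).
rewrite (L2_normZ _ (Lrem w Lw)) normrN1 mul1e; apply: le_trans.
(* This scalar, sign included, is the one that turns [v - w] into the remainder of [v] minus that of
   [w]. *)
rewrite -[leLHS]mul1e; have <- : `|- (`|h|^-1 * h)|%:E = 1%E :> \bar R.
  by rewrite normrN normrM normfV normr_id mulVf ?normr_eq0.
rewrite -L2_normZ; last exact: in_L2B.
by rewrite le_eqVlt; apply/orP; left; apply/eqP; congr L2_norm;
  apply/funext => x; ring.
Unshelve. all: by end_near. Qed.

(** The remainder of the composite splits into the remainder of [f] at the increment of [theta], and
    the remainder of [theta] carried by the vectors [v i]. *)
Lemma is_L2_diff_comp (m : nat) (f : 'cV[R]_m -> 'cV[R]_d -> R)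
    (theta : R -> 'cV[R]_m) t (v : 'I_m -> 'cV[R]_d -> R) :
  (\forall s \near t, in_L2 X lam (f (theta s))) ->
  (forall i, in_L2 X lam (v i)) ->
  derivable theta t 1 ->
  is_L2_diff X lam f (theta t) (fun h x => \sum_i h i 0 * v i x) ->
  is_L2_derive X lam (fun s => f (theta s)) t
    (fun x => \sum_i ('D_1 theta t) i 0 * v i x).
Proof.
move=> Lf Lv dtheta df.
(* The increment [k h] may vanish for nonzero [h], so the normalized remainder [E] has to be
   controlled at 0 as well as around it. *)
pose k (h : R) := theta (t + h) - theta t.
pose E (eta : 'cV[R]_m) x :=
  `|eta|^-1 * (f (theta t + eta) x - f (theta t) x - \sum_i eta i 0 * v i x).
have cvg_quot : h^-1 *: k h @[h --> 0^'] --> 'D_1 theta t.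
  have -> : (fun h => h^-1 *: k h) =
      (fun h => h^-1 *: ((theta \o shift t) (h *: 1) - theta t)).
    by apply/funext => h; rewrite /k /= [h *: 1]mulr1 [t + h]addrC.
  exact: dtheta.
(* E 0 vanishes because 0^-1 = 0, so the punctured limit extends to 0. *)
have cvg_E : L2_norm X lam (E eta) @[eta --> (0 : 'cV[R]_m)] --> 0%E.
  have E0 : L2_norm X lam (E 0) = 0%E.
    rewrite -[RHS]L2_norm0; congr L2_norm; apply/funext => x.
    by rewrite /E normr0 invr0 mul0r.
  rewrite -E0; apply/(continuous_withinNx (fun eta => L2_norm X lam (E eta))).
  by rewrite E0.
(* First term: the slope [|k h| / |h|] converges and [E (k h)] tends to 0. Second term: the
   difference quotients of [theta] converge coordinatewise and each [v i] has finite norm. *)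
pose bound h := (`| `|h|^-1 * `|k h| |%:E * L2_norm X lam (E (k h)) +
  \sum_i `|(h^-1 *: k h) i 0 - ('D_1 theta t) i 0|%:E * L2_norm X lam (v i))%E.
have cvg_bound : bound h @[h --> 0^'] --> 0%E.
  have cvg_k : k h @[h --> 0^'] --> (0 : 'cV[R]_m).
    rewrite [X in _ --> X](_ : 0 = theta t - theta t); last by rewrite subrr.
    apply: cvgB; last exact: cvg_cst.
    apply: (cvg_comp _ _ (@cvg_addl_dnbhs R t)).
    exact: (differentiable_continuous ((derivable1_diffP theta t).1 dtheta)).
  have cvg_slope : `| `|h|^-1 * `|k h| |%:E @[h --> 0^'] --> `|'D_1 theta t|%:E.
    apply: cvg_EFin; first exact: nearW.
    have -> : fine \o (fun h => `| `|h|^-1 * `|k h| |%:E) =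
        (fun h => `|h^-1 *: k h|).
      by apply/funext => h; rewrite /= normrM normr_id normrZ !normfV normr_id.
    exact: cvg_norm.
  rewrite -[X in _ --> X](adde0 0%E); apply: cvgeD => //.
    rewrite -[X in _ --> X](mule0 `|'D_1 theta t|%:E).
    apply: cvgeM cvg_slope _; first by [].
    exact: cvg_comp cvg_k cvg_E.
  rewrite [X in _ --> X](_ : 0%E = \sum_(i < m) 0)%E; last by rewrite big1.
  apply: cvg_nnesum => i _.
    by apply: nearW => h; rewrite mule_ge0 ?L2_norm_ge0.
  rewrite -[X in _ --> X](mul0e (L2_norm X lam (v i))).
  apply: cvgeZr; first exact: L2_norm_fin.
  apply: cvg_EFin; first exact: nearW.
  rewrite [X in _ --> X](_ : 0 = `|('D_1 theta t) i 0 - ('D_1 theta t) i 0|);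
    last by rewrite subrr normr0.
  apply: cvg_norm; apply: cvgB; last exact: cvg_cst.
  exact: (cvg_comp _ _ cvg_quot (@coord_continuous _ _ _ i 0 _)).
rewrite /is_L2_derive /is_L2_diff.
apply: (squeeze_cvge _ (cvg_cst 0%E) cvg_bound).
have Lf0 := nbhs_singleton Lf.
near=> h.
have h0 : h != 0 by near: h; exact: nbhs_dnbhs_neq.
have Lfh : in_L2 X lam (f (theta (t + h))).
  near: h; exact: cvg_addl_dnbhs Lf.
have LE : in_L2 X lam (E (k h)).
  apply/in_L2Z/in_L2B; last by apply: in_L2_sum => i; exact: in_L2Z.
  by rewrite /k subrKC; exact: in_L2B.
pose u i x := ((h^-1 *: k h) i 0 - ('D_1 theta t) i 0) * v i x.
rewrite L2_norm_ge0 /= /bound -L2_normZ//.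
apply: (@le_trans _ _ (L2_norm X lam (fun x => `|h|^-1 * `|k h| * E (k h) x)%R +
    L2_norm X lam (fun x => `|h|^-1 * h * \sum_i u i x)%R)%E).
  apply: le_trans (ler_L2_normD _ _); last 2 first.
  - exact: in_L2Z.
  - by apply/in_L2Z/in_L2_sum => i; exact: in_L2Z.
  rewrite le_eqVlt; apply/orP; left; apply/eqP; congr L2_norm.
  apply/funext => x; rewrite -!mulrA -mulrDr; congr (_ * _).
  have -> : `|k h| * E (k h) x =
      f (theta (t + h)) x - f (theta t) x - \sum_i k h i 0 * v i x.
    (* For [k h] nonzero its norm cancels; otherwise [theta (t + h) = theta t] and both sides are
       0. *)
    rewrite /E {3}/k subrKC; have [k0|k0] := eqVneq (k h) 0; last first.
      by rewrite mulVKf ?normr_eq0.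
    have -> : theta (t + h) = theta t by apply/eqP; rewrite -subr_eq0; apply/eqP.
    by rewrite k0 normr0 mul0r subrr big1 ?subr0// => i _; rewrite mxE mul0r.
  have -> : h * \sum_i u i x = \sum_i k h i 0 * v i x -
      h * \sum_i ('D_1 theta t) i 0 * v i x.
    rewrite !mulr_sumr -sumrB; apply: eq_bigr => i _.
    by rewrite /u mxE; field.
  by ring.
rewrite leeD2l// L2_normZ; last by apply: in_L2_sum => i; exact: in_L2Z.
have -> : `| `|h|^-1 * h| = 1.
  by rewrite normrM normfV normr_id mulVf ?normr_eq0.
rewrite mul1e (le_trans (ler_L2_norm_sum _ _))//; first by move=> i; exact: in_L2Z.
by rewrite lee_sum// => i _; rewrite L2_normZ.
Unshelve. all: by end_near. Qed.

End L2_seminorm.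

(** * Directional derivatives of logarithms *)

Lemma derive_along_line (R : realType) (V : normedModType R) (f : V -> R)
    (a v : V) : 'D_v f a = 'D_1 (fun h : R => f (h *: v + a)) 0.
Proof.
rewrite /derive; set F := (X in lim (fmap X _)); set G := (X in _ = lim (fmap X _)).
suff -> : F = G by [].
by apply/funext => h; rewrite /F /G /= scale0r add0r addr0 [h *: 1]mulr1.
Qed.

(** Only derivability of [g] along [v] is assumed, so the one-variable chain rule is applied to the
    restriction of [g] to the line through [a]. *)
Lemma is_derive_ln_comp (R : realType) (V : normedModType R) (g : V -> R) (a v : V) :
  0 < g a -> derivable g a v ->
  is_derive a v (fun y => ln (g y)) ((g a)^-1 * 'D_v g a).
Proof.
move=> ga dg; suff [dlng Dlng] : is_derive (0 : R) 1
    (fun h : R => ln (g (h *: v + a))) ((g a)^-1 * 'D_v g a).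
  by split; [exact/derivable1P|rewrite derive_along_line].
rewrite (derive_along_line g).
set g1 := fun h : R => g (h *: v + a).
have g10 : g1 0 = g a by rewrite /g1 scale0r add0r.
have dg1 : is_derive (0 : R) 1 g1 ('D_1 g1 0).
  exact: (DeriveDef ((derivable1P g a v).1 dg) erefl).
have dln : is_derive (g1 0) 1 (@ln R) (g a)^-1.
  by rewrite g10; exact: is_derive1_ln.
exact: (is_derive1_comp dln dg1).
Qed.

(* For y <= 0 both logarithms are 0. *)
Lemma ln_sqrt (R : realType) (y : R) : ln y = 2 * ln (Num.sqrt y).
Proof.
have [y0|y0] := ltP 0 y; last by rewrite ler0_sqrtr// !ln0// mulr0.
by rewrite -[in LHS](sqr_sqrtr (ltW y0)) lnXn ?sqrtr_gt0// mulr_natl.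
Qed.

(** * Score, projection and coordinates on the manifold of square roots of densities *)

Section density_family.
Context {R : realType} {d m : nat}.
Variables (X : set 'cV[R]_d) (lam : {measure set (borelType R d) -> \bar R}).
Variables (Theta : set 'cV[R]_m) (p : 'cV[R]_m -> 'cV[R]_d -> R).
Hypothesis hP : sqrt_density_manifold X lam Theta p.

Lemma in_L2_sqrt_density th : Theta th -> in_L2 X lam (sqrt_density p th).
Proof. by move=> Tth; exact: (sdm_smooth hP 0%N).1. Qed.

(* X is the positivity set of the zero extension of sqrt p_th; in_L2 makes that
   extension measurable without assuming X measurable. *)
Lemma density_measurable_support th :
  Theta th -> measurable (X : set (borelType R d)).
Proof.
move=> Tth; have := in_L2_measurable (in_L2_sqrt_density Tth).
move=> /(_ measurableT `]0, +oo[%classic (measurable_itv _)).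
rewrite setTI; congr measurable; apply/seteqP; split => x /=;
  rewrite in_itv/= andbT /patch.
  by case: ifPn => [/set_mem//|]; rewrite ltxx.
by move=> Xx; rewrite mem_set// sqrtr_gt0; exact: (sdm_pos hP).
Qed.

Lemma scoreE th i x : Theta th -> X x ->
  score p i th x = 2 * (dsqrt_density p i th x / sqrt_density p th x).
Proof.
(* [ln_sqrt] holds for every real, so it rewrites under the derivative at all [eta], even outside
   [Theta], where positivity of [p eta x] is not assumed. *)
move=> Tth Xx; rewrite /score; under eq_fun do rewrite ln_sqrt.
have S0 : 0 < sqrt_density p th x by rewrite sqrtr_gt0; exact: (sdm_pos hP).
have dS : derivable (fun eta => sqrt_density p eta x) th (basis_vec i).
  exact: (sdm_derivable hP).
have [dlnS DlnS] := @is_derive_ln_comp R _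
  (fun eta => sqrt_density p eta x) th (basis_vec i) S0 dS.
rewrite (deriveZ 2 dlnS) DlnS /dsqrt_density.
by congr (_ * _); rewrite mulrC.
Qed.

(** With $S=\sqrt{p}$, the integrand $\frac{S}{2S^2}\,\mathcal{G}^a[p]\,\partial_i S$ is a quarter
    of $\mathcal{G}^a[p]\cdot 2\,\partial_i S/S$, whose second factor is the score. *)
Lemma inner_F_half Ga DG DGa G th i : Theta th -> acts_on X Ga ->
  formal_adjoint X lam DG DGa G Ga -> DG (score p i th) -> DGa (p th) ->
  inner X lam (F_half Ga (sqrt_density p th)) (dsqrt_density p i th) =
  4^-1 * expect X lam p th (G (score p i th)).
Proof.
move=> Tth Ga_on Gadj DGs DGap.
(* Integrability from the adjoint relation allows the factor 1/4 to enter the integral. *)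
have [_ int_sGa] := Gadj _ _ DGs DGap.
rewrite /expect => ->; rewrite -RintegralZl//; last exact: density_measurable_support Tth.
apply: eq_Rintegral => x /set_mem Xx.
rewrite scoreE// /F_half.
(* The square of the root is known to be [p th] only on [X], where positivity holds; [acts_on] makes
   this sufficient. *)
have -> : Ga (fun y => sqrt_density p th y ^+ 2) x = Ga (p th) x.
  apply: Ga_on => // y Xy; rewrite sqr_sqrtr//; exact/ltW/(sdm_pos hP).
have S0 : sqrt_density p th x != 0.
  by rewrite gt_eqF// sqrtr_gt0; exact: (sdm_pos hP).
by field.
Qed.

(** Isolates the coefficient of each tangent vector, ready for comparison with the chain rule. *)
Lemma tangent_projE th v : tangent_proj X lam p th v =
  fun x => \sum_i (4 * \sum_j invmx (fisher X lam p th) i j *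
    inner X lam v (dsqrt_density p j th)) * dsqrt_density p i th x.
Proof.
apply/funext => x; rewrite /tangent_proj mulr_sumr; apply: eq_bigr => i _.
by rewrite -mulrA mulr_suml.
Qed.

(** The immersion condition is linear independence of the tangent vectors modulo null sets. *)
Lemma dsqrt_density_coord_inj th (b c : 'I_m -> R) : Theta th ->
  ae_eq lam X (fun x => \sum_i b i * dsqrt_density p i th x -
    \sum_i c i * dsqrt_density p i th x) (cst 0) -> b =1 c.
Proof.
move=> Tth bc0 i; apply/eqP; rewrite -subr_eq0; apply/eqP.
apply: (sdm_immersion hP Tth (c := fun i => b i - c i)).
apply: filterS bc0 => x bc0 /bc0 <-.
by rewrite -sumrB; apply: eq_bigr => j _; rewrite mulrBl.
Qed.

End density_family.

(** * The equation of the projected curve *)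

Unset Implicit Arguments.

Theorem proposition2 (R : realType) (d q m : nat)
    (X : set 'cV[R]_d) (lam : {measure set (borelType R d) -> \bar R})
    (a : R -> 'cV[R]_d -> 'cV[R]_d) (sigma : R -> 'cV[R]_d -> 'M[R]_(d, q))
    (Ga : R -> ('cV[R]_d -> R) -> 'cV[R]_d -> R)
    (DG DGa : set ('cV[R]_d -> R))
    (Theta : set 'cV[R]_m) (p : 'cV[R]_m -> 'cV[R]_d -> R)
    (I : set R) (theta : R -> 'cV[R]_m)
    (hX : submanifold X)
    (hP : sqrt_density_manifold X lam Theta p)
    (hI : open I)
    (hGa_on : forall t, I t -> acts_on X (Ga t))
    (hDG : forall phi, DG phi -> C2_near X phi)
    (hGa : forall t, I t ->
       formal_adjoint X lam DG DGa (generator a sigma t) (Ga t))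
    (hscore : forall th, Theta th -> forall i : 'I_m, DG (score p i th))
    (hp : forall th, Theta th -> DGa (p th))
    (hF : forall t th, I t -> Theta th ->
       in_L2 X lam (F_half (Ga t) (sqrt_density p th)))
    (htheta_in : forall t, I t -> Theta (theta t))
    (htheta_drv : forall t, I t -> derivable theta t 1)
    (hproj : forall t, I t ->
       is_L2_derive X lam (fun s => sqrt_density p (theta s)) t
         (tangent_proj X lam p (theta t)
            (F_half (Ga t) (sqrt_density p (theta t))))) :
  forall t, I t ->
    (theta^`() t)%classic =
      invmx (fisher X lam p (theta t)) *m
      \col_i expect X lam p (theta t)
               (generator a sigma t (score p i (theta t))).
Proof.
move=> t It; have Tth := htheta_in t It.
have LdS i : in_L2 X lam (dsqrt_density p i (theta t)) by exact: (sdm_dL2 hP).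
have LS : \forall s \near t, in_L2 X lam (sqrt_density p (theta s)).
  (* As [I] is open, the curve stays in [Theta] for times near [t]. *)
  near=> s; apply: (in_L2_sqrt_density hP); apply: htheta_in.
  by near: s; exact: open_nbhs_nbhs.
have := hproj t It; rewrite tangent_projE => dproj.
have dchain := is_L2_diff_comp LS LdS (htheta_drv t It) (sdm_diff hP Tth).
have Lspan (c : 'I_m -> R) :
    in_L2 X lam (fun x => \sum_i c i * dsqrt_density p i (theta t) x).
  by apply: in_L2_sum => i; exact: in_L2Z.
have coef := dsqrt_density_coord_inj hP Tth
  (is_L2_derive_unique LS (Lspan _) (Lspan _) dchain dproj).
(* The 4 in the projection cancels the 1/4 from [inner_F_half]. *)
apply/colP => i; rewrite derive1E coef mxE mulr_sumr; apply: eq_bigr => j _.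
rewrite (inner_F_half hP Tth (hGa_on t It) (hGa t It)) ?mxE//; last exact: hp.
  by field.
exact: hscore.
Unshelve. all: by end_near. Qed.
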